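(* Let $D$ be the formal derivative with respect to the grammar $G\colon x\to xy,\ y\to xz,\ z\to zw,\ w\to xz$, and let $\mathrm{Gen}(z,t)=\sum_{n\ge0}D^n(z)\,t^n/n!$. Writing $\Delta=\sqrt{(w+y)^2-4xz}$, we have $$\mathrm{Gen}(z,t)=\frac{2z\,\Delta\, e^{\frac{t}{2}(w-y+\Delta)}}{w+y+\Delta-(w+y-\Delta)e^{t\Delta}},$$ as power series in $t$.
   Context: Let $x,y,z,w$ be commuting variables. The formal derivative $D$ is the linear operator on Laurent polynomials in $x,y,z,w$ with $D(uv)=uD(v)+vD(u)$, $D(c)=0$ for constants $c$, and $D(x)=xy$, $D(y)=xz$, $D(z)=zw$, $D(w)=xz$; $D^0$ is the identity. For a Laurent polynomial $u$, $\mathrm{Gen}(u,t)=\sum_{n\ge0}D^n(u)t^n/n!$. *)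

(* Defs.v *)
From HB Require Import structures.
From mathcomp Require Import all_boot all_order all_algebra.
From mathcomp Require Import generic_quotient fraction ring.
From mathcomp.multinomials Require Import mpoly.

Set Implicit Arguments.
Unset Strict Implicit.
Unset Printing Implicit Defensive.

Import GRing.Theory.
Local Open Scope ring_scope.
Local Open Scope quotient_scope.

(* A formal power series in t over a field is its sequence of coefficients;
   two series are equal when they are pointwise equal, written f =1 g. *)

Definition fps (K : fieldType) := nat -> K.

Definition fps_const (K : fieldType) (c : K) : fps K :=
  fun n => if n is 0%N then c else 0.

Definition fps_sub (K : fieldType) (f g : fps K) : fps K := fun n => f n - g n.

Definition fps_scale (K : fieldType) (c : K) (f : fps K) : fps K :=
  fun n => c * f n.

Definition fps_mul (K : fieldType) (f g : fps K) : fps K :=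
  fun n => \sum_(i < n.+1) f i * g (n - i)%N.

Definition fps_map (K L : fieldType) (h : K -> L) (f : fps K) : fps L :=
  fun n => h (f n).

(* The first n coefficients of 1 / f, found by solving f * g = 1 for the
   coefficients of g one after the other.  Meaningful only if f 0 != 0. *)
Fixpoint fps_inv_prefix (K : fieldType) (f : fps K) (n : nat) : seq K :=
  if n is m.+1 then
    let s := fps_inv_prefix f m in
    rcons s ((f 0%N)^-1 * ((m == 0%N)%:R - \sum_(i < m) f (m - i)%N * s`_i))
  else [::].

Definition fps_inv (K : fieldType) (f : fps K) : fps K :=
  fun n => (fps_inv_prefix f n.+1)`_n.

Definition fps_div (K : fieldType) (f g : fps K) : fps K :=
  fps_mul f (fps_inv g).

(* The series e^(c t); meaningful in characteristic 0. *)
Definition fps_expt (K : fieldType) (c : K) : fps K :=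
  fun n => c ^+ n / n`!%:R.

Lemma size_fps_inv_prefix (K : fieldType) (f : fps K) n :
  size (fps_inv_prefix f n) = n.
Proof. by elim: n => //= n IHn; rewrite size_rcons IHn. Qed.

Lemma nth_fps_inv_prefix (K : fieldType) (f : fps K) n i :
  (i < n)%N -> (fps_inv_prefix f n)`_i = fps_inv f i.
Proof.
elim: n => // n IHn; rewrite ltnS leq_eqVlt => /predU1P[-> //|lt_in].
by rewrite /= nth_rcons size_fps_inv_prefix lt_in IHn.
Qed.

Lemma fps_mulfV (K : fieldType) (f : fps K) :
  f 0%N != 0 -> fps_mul f (fps_inv f) =1 fps_const 1.
Proof.
move=> f0 n; rewrite /fps_mul (reindex_inj rev_ord_inj) big_ord_recr /=.
have invE : fps_inv f n = (f 0%N)^-1 *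
    ((n == 0%N)%:R - \sum_(i < n) f (n - i)%N * fps_inv f i).
  rewrite /fps_inv /= nth_rcons size_fps_inv_prefix ltnn eqxx.
  congr (_ * (_ - _)); apply: eq_bigr => i _.
  by rewrite nth_fps_inv_prefix.
rewrite subnn subn0 invE mulVKf // [X in X + _](_ : _ =
    \sum_(i < n) f (n - i)%N * fps_inv f i).
  by rewrite addrC subrK; case: n {invE}.
by apply: eq_bigr => i _; rewrite !subSS subKn // ltnW.
Qed.

Notation "p %:F" := (@FracField.tofrac _ p) : ring_scope.

(* The field F(x, y, z, w), in which the Laurent polynomials are the fractions
   whose denominator is a monomial. *)

Definition ratfun (F : fieldType) : fieldType := {fraction {mpoly F[4]}}.

Definition const (F : fieldType) (c : F) : ratfun F := (c%:MP_[4])%:F.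

Definition var_x (F : fieldType) : ratfun F :=
  ('X_(@Ordinal 4 0 isT) : {mpoly F[4]})%:F.
Definition var_y (F : fieldType) : ratfun F :=
  ('X_(@Ordinal 4 1 isT) : {mpoly F[4]})%:F.
Definition var_z (F : fieldType) : ratfun F :=
  ('X_(@Ordinal 4 2 isT) : {mpoly F[4]})%:F.
Definition var_w (F : fieldType) : ratfun F :=
  ('X_(@Ordinal 4 3 isT) : {mpoly F[4]})%:F.

Definition laurent (F : fieldType) (u : ratfun F) : Prop :=
  exists (p : {mpoly F[4]}) (m : 'X_{1..4}),
    u = p%:F / ('X_[m] : {mpoly F[4]})%:F.

(* D is the formal derivative, on Laurent polynomials, of the grammar
   x -> x y, y -> x z, z -> z w, w -> x z.  The values of D at rational
   functions that are not Laurent polynomials are irrelevant. *)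
Record formal_derivative (F : fieldType) (D : ratfun F -> ratfun F) : Prop := {
  fd_laurent : forall u, laurent u -> laurent (D u);
  fd_linear : forall (c : F) u v, laurent u -> laurent v ->
    D (const c * u + v) = const c * D u + D v;
  fd_leibniz : forall u v, laurent u -> laurent v ->
    D (u * v) = u * D v + v * D u;
  fd_const : forall c : F, D (const c) = 0;
  fd_x : D (var_x F) = var_x F * var_y F;
  fd_y : D (var_y F) = var_x F * var_z F;
  fd_z : D (var_z F) = var_z F * var_w F;
  fd_w : D (var_w F) = var_x F * var_z F
}.

Definition Gen (F : fieldType) (D : ratfun F -> ratfun F) (u : ratfun F) :
    fps (ratfun F) :=
  fun n => iter n D u / n`!%:R.

Section QuotientRule.
Variable K : fieldType.
Implicit Types p q r s : K.

Lemma quotient_rule_wd p q r s p' q' r' s' : q != 0 -> s != 0 ->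
  p / q = r / s -> p * s' + s * p' = r * q' + q * r' ->
  (r' * s - r * s') / s ^+ 2 = (p' * q - p * q') / q ^+ 2.
Proof.
move=> q0 s0 e1 e2.
have er : r = p * s / q by rewrite mulrAC e1 mulfVK.
have es : r' = (p * s' + s * p' - r * q') / q.
  by rewrite e2 addrC addKr mulrC mulKf.
by rewrite es er; field; rewrite ?q0 ?s0.
Qed.

Lemma quotient_ruleM p q r s p' q' r' s' : q != 0 -> s != 0 ->
  ((p * r' + r * p') * (q * s) - p * r * (q * s' + s * q')) / (q * s) ^+ 2 =
  p / q * ((r' * s - r * s') / s ^+ 2) + r / s * ((p' * q - p * q') / q ^+ 2).
Proof. by move=> q0 s0; field; rewrite ?q0 ?s0. Qed.

Lemma quotient_ruleD p q r s p' q' r' s' : q != 0 -> s != 0 ->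
  ((p * s' + s * p' + (r * q' + q * r')) * (q * s)
     - (p * s + r * q) * (q * s' + s * q')) / (q * s) ^+ 2 =
  (p' * q - p * q') / q ^+ 2 + (r' * s - r * s') / s ^+ 2.
Proof. by move=> q0 s0; field; rewrite ?q0 ?s0. Qed.
End QuotientRule.

(* Such a D exists: extend the derivation of polynomials by the quotient rule. *)
Section Existence.
Variable F : fieldType.
Local Notation P := {mpoly F[4]}.
Local Notation X i := ('X_(@Ordinal 4 i isT) : P).

Let rule (i : 'I_4) : P :=
  nth 0 [:: X 0 * X 1; X 0 * X 2; X 2 * X 3; X 0 * X 2] i.

Let dpol (p : P) : P := \sum_i p^`M(i) * rule i.

Let dpolM p q : dpol (p * q) = p * dpol q + q * dpol p.
Proof.
rewrite /dpol !mulr_sumr -big_split /=; apply: eq_bigr => i _.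
by rewrite mderivM; ring.
Qed.

Let dpolD p q : dpol (p + q) = dpol p + dpol q.
Proof.
by rewrite /dpol -big_split; apply: eq_bigr => i _; rewrite mderivD mulrDl.
Qed.

Let dpolC c : dpol c%:MP = 0.
Proof. by rewrite /dpol big1 // => i _; rewrite mderivC mul0r. Qed.

Let dpolX (i : 'I_4) : dpol 'X_i = rule i.
Proof.
rewrite /dpol (bigD1 i) //= big1 ?addr0 => [|j jNi]; rewrite mderivX mnm1E.
  have -> : (U_(i) - U_(i))%MM = 0%MM :> 'X_{1..4}.
    by apply/mnmP => j; rewrite mnmBE subnn mnm0E.
  by rewrite eqxx scale1r mpolyX0 mul1r.
by rewrite eq_sym (negPf jNi) scale0r mul0r.
Qed.

Let fracP (u : ratfun F) :
  exists pq : P * P, (pq.2 != 0) && (u == pq.1%:F / pq.2%:F).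
Proof.
elim/quotW: u => -[[p q] /= q_neq0]; exists (p, q); rewrite q_neq0 /=; apply/eqP.
rewrite -[RHS]/(FracField.mul _ (FracField.inv _)) !piE.
apply/eqP; rewrite FracField.equivf_def /FracField.mulf /FracField.invf /=.
by rewrite !numden_Ratio ?oner_eq0 ?mulf_neq0 ?oner_eq0 //= !mulr1 mul1r mulrC.
Qed.

Let dfrac (u : ratfun F) : ratfun F :=
  let: (p, q) := xchoose (fracP u) in
  ((dpol p)%:F * q%:F - p%:F * (dpol q)%:F) / q%:F ^+ 2.

Let dfracE p q : q != 0 ->
  dfrac (p%:F / q%:F) =
    ((dpol p)%:F * q%:F - p%:F * (dpol q)%:F) / q%:F ^+ 2.
Proof.
move=> q0; rewrite /dfrac; case: (xchoose _) (xchooseP (fracP (p%:F / q%:F))).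
move=> r s /= /andP[s0 /eqP e1].
have q0F : q%:F != 0 by rewrite tofrac_eq0.
have s0F : s%:F != 0 by rewrite tofrac_eq0.
apply: (quotient_rule_wd q0F s0F e1).
rewrite -!tofracM -!tofracD -!dpolM; congr ((dpol _)%:F).
apply/eqP; rewrite -tofrac_eq !tofracM; apply/eqP.
by rewrite -(mulfVK q0F p%:F) e1 mulrAC mulfVK.
Qed.

Let dpolE p : dfrac p%:F = (dpol p)%:F.
Proof.
have d1 : dpol 1 = 0 by rewrite -mpolyC1 dpolC.
have := dfracE p (oner_neq0 _).
by rewrite d1 tofrac1 tofrac0 mulr0 subr0 expr1n !divr1 mulr1.
Qed.

Let dfracM u v : dfrac (u * v) = u * dfrac v + v * dfrac u.
Proof.
have [[p q] /= /andP[q0 /eqP->]] := fracP u.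
have [[r s] /= /andP[s0 /eqP->]] := fracP v.
rewrite mulf_div -!tofracM !dfracE ?mulf_neq0 // !dpolM !tofracD !tofracM.
by apply: quotient_ruleM; rewrite tofrac_eq0.
Qed.

Let dfracD u v : dfrac (u + v) = dfrac u + dfrac v.
Proof.
have [[p q] /= /andP[q0 /eqP->]] := fracP u.
have [[r s] /= /andP[s0 /eqP->]] := fracP v.
rewrite addf_div ?tofrac_eq0 // -!tofracM -tofracD.
rewrite !dfracE ?mulf_neq0 // !(dpolD, dpolM, tofracD, tofracM).
by apply: quotient_ruleD; rewrite tofrac_eq0.
Qed.

Lemma formal_derivative_exists :
  exists D : ratfun F -> ratfun F, formal_derivative D.
Proof.
exists dfrac; split.
- move=> _ [p [m ->]].
  exists (dpol p * 'X_[m] - p * dpol 'X_[m]), (m + m)%MM.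
  have X0 : ('X_[m] : P) != 0 by rewrite -msupp_eq0 msuppX.
  by rewrite dfracE // mpolyXD tofracB !tofracM expr2.
- move=> c u v _ _; rewrite dfracD dfracM.
  by rewrite /const dpolE dpolC tofrac0 mulr0 addr0.
- by move=> u v _ _; exact: dfracM.
- by move=> c; rewrite /const dpolE dpolC tofrac0.
- by rewrite /var_x dpolE dpolX tofracM.
- by rewrite /var_y dpolE dpolX tofracM.
- by rewrite /var_z dpolE dpolX tofracM.
- by rewrite /var_w dpolE dpolX tofracM.
Qed.

End Existence.

(* Main.v *)
Require Import Defs.
From mathcomp Require Import all_boot all_order all_algebra.
From mathcomp Require Import fraction ring.
From mathcomp.multinomials Require Import mpoly.
Set Implicit Arguments.
Unset Strict Implicit.
Unset Printing Implicit Defensive.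
Import GRing.Theory.
Local Open Scope ring_scope.

(* Put c = w - y and h = 1/z.  Then D h = - w h, and
   D^2 h = - c (D h) + (w y - x z) h, where D kills both c and w y - x z.
   So Gen(h,t) satisfies a second order linear equation with constant
   coefficients, whose characteristic roots are (- c +/- Delta) / 2, and is a
   combination of two exponentials.  The Leibniz rule gives
   Gen(z,t) Gen(h,t) = Gen(1,t) = 1, hence Gen(z,t) is its reciprocal. *)

(** * Algebra, differentiation and exponentials of formal power series *)

Section PowerSeries.
Variable K : fieldType.
Implicit Types (f g h : fps K) (c d : K).

Lemma fps_mul_eq f f' g g' :
  f =1 f' -> g =1 g' -> fps_mul f g =1 fps_mul f' g'.
Proof. by move=> ef eg n; apply: eq_bigr => i _; rewrite ef eg. Qed.

(** A coefficient of a Cauchy product involves only finitely many terms, so commutativity and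
    associativity can be inherited from [{poly K}] by truncation. *)
Lemma coefM_fps (p q : {poly K}) f g n :
    (forall i, (i <= n)%N -> p`_i = f i) ->
    (forall i, (i <= n)%N -> q`_i = g i) ->
  (p * q)`_n = fps_mul f g n.
Proof.
move=> pf qg; rewrite coefM; apply: eq_bigr => i _.
by rewrite pf ?qg ?leq_subr // -ltnS.
Qed.

Let trunc n f : {poly K} := \poly_(i < n.+1) f i.

Let coef_trunc n f i : (i <= n)%N -> (trunc n f)`_i = f i.
Proof. by move=> le_in; rewrite coef_poly ltnS le_in. Qed.

Let coefM_trunc n f g i :
  (i <= n)%N -> (trunc n f * trunc n g)`_i = fps_mul f g i.
Proof.
by move=> le_in; apply: coefM_fps => j le_ji;
  rewrite coef_trunc // (leq_trans le_ji).
Qed.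

Lemma fps_mulC f g : fps_mul f g =1 fps_mul g f.
Proof. by move=> n; rewrite -!(@coefM_trunc n) // mulrC. Qed.

Lemma fps_mulA f g h : fps_mul f (fps_mul g h) =1 fps_mul (fps_mul f g) h.
Proof.
move=> n; transitivity (trunc n f * (trunc n g * trunc n h))`_n.
  by apply/esym/coefM_fps => i; [apply: coef_trunc | apply: coefM_trunc].
rewrite mulrA.
by apply: coefM_fps => i; [apply: coefM_trunc | apply: coef_trunc].
Qed.

Lemma fps_mul1 f : fps_mul f (fps_const 1) =1 f.
Proof.
move=> n; rewrite fps_mulC /fps_mul big_ord_recl subn0 mul1r big1 ?addr0 //.
by move=> i _; rewrite mul0r.
Qed.

Lemma fps_mul_scale c f g :
  fps_mul (fps_scale c f) g =1 fps_scale c (fps_mul f g).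
Proof.
by move=> n; rewrite /fps_scale mulr_sumr; apply: eq_bigr => i _; rewrite mulrA.
Qed.

Lemma fps_eq_div f g h : g 0%N != 0 -> fps_mul f g =1 h -> f =1 fps_div h g.
Proof.
move=> g0 fg n; rewrite -(fps_mul1 f) -(fps_mul_eq (frefl f) (fps_mulfV g0)).
by rewrite fps_mulA; apply: fps_mul_eq.
Qed.

(** The product rule for d/dt: the sequence [k.+1%:R * f k.+1] is the derivative of [f]. *)
Lemma fps_mul_deriv f g n :
  n.+1%:R * fps_mul f g n.+1 =
    fps_mul (fun k => k.+1%:R * f k.+1) g n +
    fps_mul f (fun k => k.+1%:R * g k.+1) n.
Proof.
(* In each term n+1 is split as i + (n+1-i); the term i = 0 of the first sum and the term i = n+1 of
   the second then vanish. *)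
rewrite mulr_sumr; transitivity
  (\sum_(i < n.+2) i%:R * f i * g (n.+1 - i)%N +
   \sum_(i < n.+2) f i * ((n.+1 - i)%:R * g (n.+1 - i)%N)).
  rewrite -big_split; apply: eq_bigr => i _ /=.
  have <- : i%:R + (n.+1 - i)%:R = n.+1%:R :> K.
    by rewrite -natrD subnKC ?leq_ord.
  by ring.
congr (_ + _); first by rewrite big_ord_recl !mul0r add0r.
rewrite big_ord_recr /= subnn mul0r mulr0 addr0; apply: eq_bigr => i _.
by rewrite subSn // leq_ord.
Qed.

Hypothesis natf_neq0 : forall n, n.+1%:R != 0 :> K.

Lemma fact_neq0 n : n`!%:R != 0 :> K.
Proof. by rewrite -(prednK (fact_gt0 n)). Qed.

Lemma divf_fact_deriv c n : n.+1%:R * (c / n.+1`!%:R) = c / n`!%:R.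
Proof. by rewrite factS natrM invfM mulrCA mulVKf. Qed.

(** This is the binomial theorem divided by n!. *)
Lemma fps_exptD c d :
  fps_expt (c + d) =1 fps_mul (fps_expt c) (fps_expt d).
Proof.
move=> n; rewrite fps_mulC /fps_expt exprDn mulr_suml.
apply: eq_bigr => i _; have le_in := leq_ord i.
have := bin_fact le_in => /(congr1 (fun k => k%:R : K)); rewrite !natrM => <-.
have bin0 : 'C(n, i)%:R != 0 :> K.
  by case: 'C(n, i) (bin_gt0 n i) => [|k]; rewrite ?le_in.
by rewrite -mulr_natr; field; rewrite bin0 !fact_neq0.
Qed.

End PowerSeries.

(** * The grammar: Laurent polynomials, the recurrence for 1/z, and generating functions *)

Section Grammar.
Variables (F : fieldType) (F_char0 : [pchar F] =i pred0).
Variables (D : ratfun F -> ratfun F) (D_derivative : formal_derivative D).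
Implicit Types u v : ratfun F.

Local Notation x := (var_x F).
Local Notation y := (var_y F).
Local Notation z := (var_z F).
Local Notation w := (var_w F).

Lemma ratfun_nat_neq0 n : n.+1%:R != 0 :> ratfun F.
Proof.
rewrite -(rmorph_nat (@FracField.tofrac _)) tofrac_eq0.
rewrite -(rmorph_nat (@mpolyC 4 F)) mpolyC_eq0.
by rewrite (iffLR (pcharf0P F) F_char0).
Qed.

(** The rules for [D] hold on Laurent polynomials only; this and the next closure lemmas discharge
    that side condition. *)
Lemma laurent_poly (p : {mpoly F[4]}) : laurent p%:F.
Proof. by exists p, 0%MM; rewrite mpolyX0 tofrac1 divr1. Qed.

Lemma mpolyX_neq0 (m : 'X_{1..4}) : ('X_[m] : {mpoly F[4]})%:F != 0.
Proof. by rewrite tofrac_eq0 -msupp_eq0 msuppX. Qed.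

Lemma laurentM u v : laurent u -> laurent v -> laurent (u * v).
Proof.
move=> [p [m ->]] [q [k ->]]; exists (p * q), (m + k)%MM.
by rewrite mulf_div mpolyXD !tofracM.
Qed.

Lemma laurentD u v : laurent u -> laurent v -> laurent (u + v).
Proof.
move=> [p [m ->]] [q [k ->]].
exists (p * 'X_[k] + q * 'X_[m]), (m + k)%MM.
by rewrite addf_div ?mpolyX_neq0 // mpolyXD tofracD !tofracM.
Qed.

Lemma laurentN u : laurent u -> laurent (- u).
Proof. by move=> [p [m ->]]; exists (- p), m; rewrite tofracN mulNr. Qed.

Lemma laurent_iter n u : laurent u -> laurent (iter n D u).
Proof. by move=> Lu; elim: n => //= n; apply: (fd_laurent D_derivative). Qed.

Lemma laurent_zV : laurent z^-1.
Proof. by exists 1, U_(@Ordinal 4 2 isT)%MM; rewrite tofrac1 mul1r. Qed.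

Let Lx : laurent x := laurent_poly _.
Let Ly : laurent y := laurent_poly _.
Let Lz : laurent z := laurent_poly _.
Let Lw : laurent w := laurent_poly _.

Lemma fdD u v : laurent u -> laurent v -> D (u + v) = D u + D v.
Proof.
move=> Lu Lv; have := fd_linear D_derivative 1 Lu Lv.
by rewrite /const mpolyC1 tofrac1 !mul1r.
Qed.

Lemma fd0 : D 0 = 0.
Proof. by have := fd_const D_derivative 0; rewrite /const mpolyC0 tofrac0. Qed.

Lemma fd1 : D 1 = 0.
Proof. by have := fd_const D_derivative 1; rewrite /const mpolyC1 tofrac1. Qed.

Lemma fdN u : laurent u -> D (- u) = - D u.
Proof.
move=> Lu; apply/eqP; rewrite -addr_eq0 -fdD //; last exact: laurentN.
by rewrite addNr fd0.
Qed.

Lemma fdM u v : laurent u -> laurent v -> D (u * v) = u * D v + v * D u.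
Proof. exact: (fd_leibniz D_derivative). Qed.

Let z_neq0 : z != 0.
Proof. exact: mpolyX_neq0. Qed.

(** Apply [D] to z z^-1 = 1. *)
Lemma fd_zV : D z^-1 = - w * z^-1.
Proof.
have := fdM Lz laurent_zV; rewrite divff // fd1 (fd_z D_derivative) mulKf //.
move=> e; apply: (mulfI z_neq0); apply/eqP.
by rewrite mulNr mulrN mulrCA divff // mulr1 -addr_eq0 -e.
Qed.

Lemma fd_wBy : D (w - y) = 0.
Proof.
by rewrite fdD ?fdN ?(fd_w D_derivative) ?(fd_y D_derivative) ?subrr //;
  apply: laurentN.
Qed.

(** Both D(w y) and D(x z) equal x z (w + y). *)
Lemma fd_wyBxz : D (w * y - x * z) = 0.
Proof.
rewrite fdD ?fdN ?fdM //; [| exact: laurentM.. | exact/laurentN/laurentM].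
by case: D_derivative => _ _ _ _ -> -> -> ->; ring.
Qed.

Lemma fd2_zV n :
  iter n.+2 D z^-1 =
    (w * y - x * z) * iter n D z^-1 - (w - y) * iter n.+1 D z^-1.
Proof.
have LzV := laurent_iter _ laurent_zV.
have Lc : laurent (w - y) by apply/laurentD/laurentN.
have Le : laurent (w * y - x * z).
  by apply/laurentD/laurentN; apply: laurentM.
elim: n => [|n IHn].
  rewrite /= fd_zV fdM ?fdN // ?fd_zV ?(fd_w D_derivative); first by ring.
  - exact: laurentN.
  - exact: laurent_zV.
(* Apply [D] once more: it kills both coefficients of the recurrence, so it acts only on the
   iterates. *)
rewrite [LHS]iterS IHn fdD ?fdN ?fdM ?fd_wBy ?fd_wyBxz //.
- by rewrite !mulr0 !addr0 -!iterS IHn.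
- exact: laurentM.
- exact: laurentM.
- by apply/laurentN/laurentM.
Qed.

(** Differentiating in t amounts to applying [D] to the argument. *)
Lemma Gen_deriv u n : n.+1%:R * Gen D u n.+1 = Gen D (D u) n.
Proof.
by rewrite /Gen (divf_fact_deriv ratfun_nat_neq0) iterSr.
Qed.

Lemma iter_fdD n u v :
  laurent u -> laurent v -> iter n D (u + v) = iter n D u + iter n D v.
Proof.
by move=> Lu Lv; elim: n => //= n ->; rewrite fdD //; apply: laurent_iter.
Qed.

(** Both sides have constant term u v, and their t-derivatives follow the same product rule. The
    induction keeps [u] and [v] general because it is used at the pairs (u, D v) and (v, D u). *)
Lemma Gen_mul u v :
  laurent u -> laurent v -> Gen D (u * v) =1 fps_mul (Gen D u) (Gen D v).
Proof.
move=> Lu Lv n; elim: n u v Lu Lv => [|n IHn] u v Lu Lv.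
  by rewrite /fps_mul big_ord1 /Gen /= !divr1.
have LDu := fd_laurent D_derivative Lu; have LDv := fd_laurent D_derivative Lv.
apply: (mulfI (ratfun_nat_neq0 n)); rewrite fps_mul_deriv Gen_deriv fdM //.
rewrite {1}/Gen iter_fdD ?mulrDl; try exact: laurentM.
rewrite -/(Gen D (u * D v) n) -/(Gen D (v * D u) n) !IHn // addrC.
rewrite [fps_mul (Gen D v) _ _]fps_mulC.
by congr (_ + _); apply: fps_mul_eq => // k; rewrite Gen_deriv.
Qed.

Lemma Gen_zVK : fps_mul (Gen D z) (Gen D z^-1) =1 fps_const 1.
Proof.
move=> n; rewrite -Gen_mul //; last exact: laurent_zV.
rewrite divff // /Gen; case: n => [|n]; first by rewrite divr1.
suff D0 : iter n D 0 = 0 by rewrite iterSr fd1 D0 mul0r.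
by elim: n => //= n ->; apply: fd0.
Qed.

Lemma discriminant_neq0 : (w + y) ^+ 2 - 4 * x * z != 0.
Proof.
pose X i : {mpoly F[4]} := 'X_i; pose o k (lt_k4 : (k < 4)%N) := Ordinal lt_k4.
pose p := (X (o 3 isT) + X (o 1 isT)) ^+ 2 - 4 * X (o 0 isT) * X (o 2 isT).
have -> : (w + y) ^+ 2 - 4 * x * z = p%:F.
  by rewrite rmorphB rmorphXn rmorphD !rmorphM (rmorph_nat _ 4).
rewrite tofrac_eq0; apply/eqP.
(* At y = 1, x = z = w = 0 the discriminant takes the value 1. *)
move=> /(congr1 (meval (fun i : 'I_4 => (i == 1%N :> nat)%:R))).
rewrite rmorphB rmorphXn rmorphD !rmorphM rmorph0 /= !mevalXU /=.
by rewrite !mulr0 add0r expr1n subr0 => /eqP; rewrite oner_eq0.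
Qed.

(** * Closed form of D^n(1/z) in a field containing Delta *)

Section Extension.
Variables (K : fieldType) (iota : {rmorphism ratfun F -> K}) (Delta : K).
Hypothesis Delta_sqrt : Delta ^+ 2 = iota ((w + y) ^+ 2 - 4 * x * z).

Lemma ext_nat_neq0 n : n.+1%:R != 0 :> K.
Proof. by rewrite -(rmorph_nat iota) fmorph_eq0 ratfun_nat_neq0. Qed.

(** Both sides satisfy the recurrence [fd2_zV], the two bases being its characteristic roots; the
    coefficients fit the initial values 1/z and -w/z. *)
Lemma iter_fd_zV n :
  2 * iota z * Delta * iota (iter n D z^-1) =
    (iota w + iota y + Delta) * (- (iota w - iota y + Delta) / 2) ^+ n -
    (iota w + iota y - Delta) * ((Delta - (iota w - iota y)) / 2) ^+ n.
Proof.
have two0 : 2 != 0 :> K := ext_nat_neq0 1.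
have zi0 : iota z != 0 by rewrite fmorph_eq0.
have e : Delta ^+ 2 = (iota w + iota y) ^+ 2 - 4 * iota x * iota z.
  by rewrite Delta_sqrt rmorphB rmorphXn rmorphD !rmorphM (rmorph_nat _ 4).
(* Eliminating x z removes the relation on Delta, so [field] can treat w, y and Delta as
   independent. *)
have exz : iota x * iota z = ((iota w + iota y) ^+ 2 - Delta ^+ 2) / 4.
  by rewrite e; field; rewrite (ext_nat_neq0 3).
pose r k := (iota w + iota y + Delta) * (- (iota w - iota y + Delta) / 2) ^+ k -
  (iota w + iota y - Delta) * ((Delta - (iota w - iota y)) / 2) ^+ k.
(* The recurrence has order two, so the induction carries two consecutive values. *)
suff [] : 2 * iota z * Delta * iota (iter n D z^-1) = r n /\
    2 * iota z * Delta * iota (iter n.+1 D z^-1) = r n.+1 by [].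
rewrite /r {r}; elim: n => [|n [IH0 IH1]].
  rewrite /= fd_zV rmorphM rmorphN fmorphV.
  by split; field; rewrite ?zi0 ?two0.
split=> //; rewrite fd2_zV !(rmorphB, rmorphM) mulrBr.
rewrite mulrCA [X in _ - X]mulrCA IH0 IH1 exz !exprSr.
by field; rewrite ?two0 ?(ext_nat_neq0 3).
Qed.

End Extension.
End Grammar.

Theorem theorem3p1 (F : fieldType) (F_char0 : [pchar F] =i pred0)
    (D : ratfun F -> ratfun F) (D_derivative : formal_derivative D)
    (K : fieldType) (iota : {rmorphism ratfun F -> K}) (Delta : K)
    (Delta_sqrt :
      Delta ^+ 2 = iota ((var_w F + var_y F) ^+ 2 - 4 * var_x F * var_z F)) :
  let y := iota (var_y F) in
  let z := iota (var_z F) in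
  let w := iota (var_w F) in
  fps_map iota (Gen D (var_z F)) =1
    fps_div
      (fps_scale (2 * z * Delta) (fps_expt ((w - y + Delta) / 2)))
      (fps_sub (fps_const (w + y + Delta))
               (fps_scale (w + y - Delta) (fps_expt Delta))).
Proof.
move=> y z w; set A := fps_sub _ _.
have nat0 := ext_nat_neq0 F_char0 iota; have two0 := nat0 1%N.
have Delta0 : Delta != 0.
  by rewrite -sqrf_eq0 Delta_sqrt fmorph_eq0 discriminant_neq0.
set g := fps_map iota _; set E := fps_expt ((w - y + Delta) / 2).
pose h := fps_map iota (Gen D (var_z F)^-1).
have gh : fps_mul g h =1 fps_const 1.
  move=> n.
  transitivity (iota (fps_mul (Gen D (var_z F)) (Gen D (var_z F)^-1) n)).
    by rewrite rmorph_sum; apply: eq_bigr => i _; rewrite rmorphM.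
  by rewrite Gen_zVK //; case: n => [|n]; rewrite ?rmorph1 ?rmorph0.
have hE : fps_scale (2 * z * Delta) h =1
    fps_sub (fps_scale (w + y + Delta) (fps_expt (- (w - y + Delta) / 2)))
            (fps_scale (w + y - Delta) (fps_expt ((Delta - (w - y)) / 2))).
  move=> n; rewrite /fps_scale /h /fps_map /Gen fmorph_div mulrA.
  rewrite iter_fd_zV // rmorph_nat -/w -/y /fps_sub /fps_expt.
  by rewrite mulrBl -!mulrA.
(* Multiplying by [E] cancels the first exponent and turns the second into Delta, which produces the
   denominator. *)
have EhA : fps_mul E (fps_scale (2 * z * Delta) h) =1 A.
  move=> n; rewrite (fps_mul_eq (frefl E) hE).
  transitivity (fps_sub
    (fps_scale (w + y + Delta)
      (fps_expt ((w - y + Delta) / 2 - (w - y + Delta) / 2)))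
    (fps_scale (w + y - Delta)
      (fps_expt ((w - y + Delta) / 2 + (Delta - (w - y)) / 2))) n).
    rewrite /fps_sub /fps_scale !(fps_exptD nat0) /fps_mul !mulr_sumr -sumrB.
    by apply: eq_bigr => i _; rewrite mulNr -/E; ring.
  have -> : (w - y + Delta) / 2 + (Delta - (w - y)) / 2 = Delta by field.
  rewrite subrr /A /fps_sub; congr (_ - _); rewrite /fps_scale /fps_expt.
  by case: n => [|n]; rewrite ?expr0 ?divr1 ?mulr1 // expr0n mul0r mulr0.
(* Division is legitimate since [A] has constant term 2 Delta, which is nonzero. *)
apply: fps_eq_div.
  rewrite /A /fps_sub /fps_scale /fps_expt /= divr1 mulr1.
  have -> : w + y + Delta - (w + y - Delta) = 2 * Delta by ring.
  by rewrite mulf_neq0.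
(* Now g A = g E (2 z Delta h), and g h = 1 leaves 2 z Delta E. *)
move=> n; rewrite -(fps_mul_eq (frefl g) EhA).
rewrite fps_mulA (fps_mul_eq (fps_mulC g E) (frefl _)) -fps_mulA.
rewrite (fps_mul_eq (frefl E) (fps_mulC _ _)).
rewrite (fps_mul_eq (frefl E) (fps_mul_scale _ _ _)) fps_mulC fps_mul_scale.
rewrite /fps_scale fps_mulC (fps_mul_eq (frefl E) (fps_mulC _ _)).
by rewrite (fps_mul_eq (frefl E) gh) fps_mul1.
Qed.
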